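(* Let $G$ be any group. Then $\mathcal P_+(G)$, with setwise multiplication, and the Kleisli Hom-space $\mathrm{Hom}_{\mathbf{Kl}(\mathscr P_+)}(1,G)$, with the convolution $\star$ as multiplication, are monoids, and there is an isomorphism of monoids $$\mathrm{Hom}_{\mathbf{Kl}(\mathscr P_+)}(1,G)\;\cong\;\mathcal P_+(G).$$ The same assertion holds with $\mathscr P_+$ replaced by $\mathscr P_{\mathrm{fin}}$ (and $\mathcal P_+(G)$ replaced by $\mathcal P_{\mathrm{fin}}(G)$).
   Context: For a set $X$, $\mathcal P_+(X)$ is the set of all non-empty subsets of $X$, and $\mathcal P_{\mathrm{fin}}(X)$ is the set of all non-empty finite subsets of $X$. For a group $G$, both $\mathcal P_+(G)$ and $\mathcal P_{\mathrm{fin}}(G)$ carry the setwise multiplication $AB=\{ab: a\in A,\ b\in B\}$. The monad $\mathscr P_+=(\mathcal P_+,\eta,\mu)$ on the category of sets: $\mathcal P_+$ acts on maps by direct image, $\eta_X(x)=\{x\}$, and $\mu_X(\mathcal A)=\bigcup_{A\in\mathcal A}A$. The monad $\mathscr P_{\mathrm{fin}}=(\mathcal P_{\mathrm{fin}},\eta,\mu)$ on the category of sets is defined by the same formulas. For $\mathscr T=(T,\eta,\mu)$ either of these monads, the Kleisli category $\mathbf{Kl}(\mathscr T)$ has sets as objects, and a morphism (Kleisli arrow) $f:X\rightsquigarrow Y$ is a map $f:X\to T(Y)$. The composite of $f:X\rightsquigarrow Y$ and $g:Y\rightsquigarrow Z$ is $x\mapsto\bigcup_{y\in f(x)}g(y)$,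 and identities are given by $\eta$. The tensor product is $X\otimes Y=X\times Y$ on objects and $(f\otimes g)(x,x')=f(x)\times g(x')$ on arrows. An ordinary map $h:X\to Y$ is regarded as the Kleisli arrow $x\mapsto\{h(x)\}$. $1=\{*\}$ is a one-point set, with diagonal $\Delta:1\to 1\times 1$, $*\mapsto( *,* )$, and $m:G\times G\to G$ is the group multiplication. The convolution of $f,g\in\mathrm{Hom}_{\mathbf{Kl}(\mathscr T)}(1,G)$ is the Kleisli composite $f\star g:=m\circ(f\otimes g)\circ\Delta:1\rightsquigarrow G$. *)

(* Defs.v *)
From HB Require Import structures.
From mathcomp Require Import all_boot.
From mathcomp Require Import boolp classical_sets cardinality.

Set Implicit Arguments.
Unset Strict Implicit.
Unset Printing Implicit Defensive.

Local Open Scope classical_set_scope.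
Local Open Scope group_scope.

(* A submonad of the powerset monad, given by a class of "small" subsets of
   each type: the two closure conditions say that the unit x |-> [set x] and
   the multiplication (union) restrict to small subsets. Stability under
   direct images and products follows. *)
Record power_monad := PowerMonad {
  small : forall X : Type, set X -> Prop ;
  small_set1 : forall (X : Type) (x : X), small [set x] ;
  small_bigcup : forall (X Y : Type) (A : set X) (F : X -> set Y),
    small A -> (forall x, A x -> small (F x)) ->
    small (\bigcup_(x in A) F x)
}.

Lemma small_image (T : power_monad) (X Y : Type) (f : X -> Y) (A : set X) :
  small T A -> small T (f @` A).
Proof.
by move=> sA; rewrite -bigcup_imset1; apply: small_bigcup => // x _;
  apply: small_set1.
Qed.

Lemma small_setX (T : power_monad) (X Y : Type) (A : set X) (B : set Y) :
  small T A -> small T B -> small T (A `*` B).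
Proof.
move=> sA sB.
have -> : A `*` B = \bigcup_(x in A) (pair x @` B).
  apply/seteqP; split=> [[x y] [/= Ax By]|_ [x Ax [y By <-]]]; last by [].
  by exists x => //; exists y.
by apply: small_bigcup => // x _; apply: small_image.
Qed.

Lemma nonempty_set1 (X : Type) (x : X) : [set x] !=set0.
Proof. by exists x. Qed.

Lemma nonempty_bigcup (X Y : Type) (A : set X) (F : X -> set Y) :
  A !=set0 -> (forall x, A x -> F x !=set0) ->
  (\bigcup_(x in A) F x) !=set0.
Proof. by move=> [x Ax] /(_ x Ax) [y Fxy]; exists y, x. Qed.

Definition Pplus : power_monad :=
  @PowerMonad (fun X A => A !=set0) nonempty_set1 nonempty_bigcup.

Lemma nonempty_finite_set1 (X : Type) (x : X) :
  [set x] !=set0 /\ finite_set [set x].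
Proof. by split; [exists x | apply: finite_set1]. Qed.

Lemma nonempty_finite_bigcup (X Y : Type) (A : set X) (F : X -> set Y) :
  A !=set0 /\ finite_set A -> (forall x, A x -> F x !=set0 /\ finite_set (F x)) ->
  (\bigcup_(x in A) F x) !=set0 /\ finite_set (\bigcup_(x in A) F x).
Proof.
move=> [A0 Afin] AF; split.
  by apply: nonempty_bigcup => // x /AF[].
by apply: bigcup_finite => // x /AF[].
Qed.

Definition Pfin : power_monad :=
  @PowerMonad (fun X A => A !=set0 /\ finite_set A)
    nonempty_finite_set1 nonempty_finite_bigcup.

Section Monad.
Variable T : power_monad.

Definition pow (X : Type) : Type := {A : set X | small T A}.

Definition pow_map (X Y : Type) (f : X -> Y) (A : pow X) : pow Y :=
  exist _ (f @` sval A) (small_image f (svalP A)).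

Definition pow_unit (X : Type) (x : X) : pow X :=
  exist _ [set x] (small_set1 T x).

Definition pow_join (X : Type) (AA : pow (pow X)) : pow X :=
  exist _ (\bigcup_(A in sval AA) sval A)
    (small_bigcup (svalP AA) (fun A _ => svalP A)).

Definition kl_hom (X Y : Type) : Type := X -> pow Y.

Definition kl_comp (X Y Z : Type) (g : kl_hom Y Z) (f : kl_hom X Y) :
    kl_hom X Z :=
  fun x => exist _ (\bigcup_(y in sval (f x)) sval (g y))
    (small_bigcup (svalP (f x)) (fun y _ => svalP (g y))).

Lemma kl_compE (X Y Z : Type) (g : kl_hom Y Z) (f : kl_hom X Y) (x : X) :
  kl_comp g f x = pow_join (pow_map g (f x)).
Proof. by apply: eq_exist; rewrite bigcup_image. Qed.

Definition kl_pure (X Y : Type) (h : X -> Y) : kl_hom X Y :=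
  fun x => pow_unit (h x).

Definition kl_tensor (X Y X' Y' : Type) (f : kl_hom X Y) (g : kl_hom X' Y') :
    kl_hom (X * X') (Y * Y') :=
  fun p => exist _ (sval (f p.1) `*` sval (g p.2))
    (small_setX (svalP (f p.1)) (svalP (g p.2))).

Definition diag1 (u : unit) : unit * unit := (u, u).

Variable G : groupType.

Definition conv (f g : kl_hom unit G) : kl_hom unit G :=
  kl_comp (kl_pure (fun p : G * G => p.1 * p.2))
    (kl_comp (kl_tensor f g) (kl_pure diag1)).

Lemma small_setM (A B : pow G) :
  small T [set a * b | a in sval A & b in sval B].
Proof.
by rewrite image2E; apply/small_image/small_setX; apply: svalP.
Qed.

Definition pow_mul (A B : pow G) : pow G :=
  exist _ [set a * b | a in sval A & b in sval B] (small_setM A B).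

(* Only operations and units are attached here; no monoid law is. *)
HB.instance Definition _ := hasMul.Build (pow G) pow_mul.
HB.instance Definition _ := hasOne.Build (pow G) (pow_unit 1).

HB.instance Definition _ := hasMul.Build (kl_hom unit G) conv.
HB.instance Definition _ :=
  hasOne.Build (kl_hom unit G) (kl_pure (fun _ : unit => 1)).

End Monad.

Definition is_monoid (M : baseUMagmaType) : Prop :=
  [/\ associative (fun x y : M => x * y),
      left_id 1 (fun x y : M => x * y) &
      right_id 1 (fun x y : M => x * y)].

Definition monoid_isomorphic (M N : baseUMagmaType) : Prop :=
  exists phi : M -> N, bijective phi /\ monoid_morphism phi.

(* Main.v *)
(** Evaluation at the point of [unit] is a bijection from Kleisli arrows
    [1 ~> G] onto small subsets of [G]. It turns convolution into setwise
    multiplication, so the monoid laws of the Hom-space are transported from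
    those of the setwise product. *)

Require Import Defs.
From mathcomp Require Import all_boot.
From mathcomp Require Import boolp classical_sets.

Local Open Scope classical_set_scope.
Local Open Scope group_scope.

(** By proof irrelevance, a small subset is determined by its underlying set, so equations in [pow]
    reduce to extensional equality of sets. *)
Lemma pow_inj (T : power_monad) (X : Type) (A B : pow T X) :
  sval A = sval B -> A = B.
Proof. by case: A B => [A sA] [B sB] /= AB; apply: eq_exist. Qed.

Lemma pow_is_monoid (T : power_monad) (G : groupType) : is_monoid (pow T G).
Proof.
split=> [A B C|A|A]; apply: pow_inj; apply/seteqP; split=> x /=.
- move=> [a Aa [_ [b Bb [c Cc <-]] <-]].
  by exists (a * b); [exists a => //; exists b|exists c; rewrite ?mulgA].
- move=> [_ [a Aa [b Bb <-]] [c Cc <-]].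
  by exists a => //; exists (b * c); [exists b => //; exists c|rewrite mulgA].
- by move=> [_ -> [a Aa <-]]; rewrite mul1g.
- by move=> Ax; exists 1 => //; exists x; rewrite ?mul1g.
- by move=> [a Aa [_ -> <-]]; rewrite mulg1.
- by move=> Ax; exists x => //; exists 1; rewrite ?mulg1.
Qed.

Lemma kl_eval_bij (T : power_monad) (X : Type) :
  bijective (fun f : kl_hom T unit X => f tt).
Proof.
(* The inverse sends a small set to the constant arrow at it. *)
by exists (fun A => fun=> A) => [f|//]; apply/funext; case.
Qed.

(** At [tt] the diagonal contributes the single index [(tt, tt)], so the composite unfolds to the
    union of the singletons of [a * b] over pairs in the product of [f tt] and [g tt]. The units
    agree by computation. *)
Lemma kl_eval_morphism (T : power_monad) (G : groupType) :
  monoid_morphism (fun f : kl_hom T unit G => f tt).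
Proof.
split=> // f g; apply: pow_inj; apply/seteqP; split=> x /=.
  by move=> [[a b] [_ -> [/= fa gb]] ->]; exists a => //; exists b.
move=> [a fa [b gb <-]]; exists (a, b) => //.
by exists (tt, tt).
Qed.

(** An injective morphism reflects equations: both sides of each law have the same image in [N]. *)
Lemma is_monoid_inj (M N : baseUMagmaType) (phi : M -> N) :
  injective phi -> monoid_morphism phi -> is_monoid N -> is_monoid M.
Proof.
move=> phi_inj [phi1 phiM] [mulA mul1 mulr1].
split=> [x y z|x|x]; apply: phi_inj; rewrite !phiM ?phi1.
- exact: mulA.
- exact: mul1.
- exact: mulr1.
Qed.

Lemma kl_hom_is_monoid (T : power_monad) (G : groupType) :
  is_monoid (kl_hom T unit G).
Proof.
apply: is_monoid_inj (kl_eval_morphism T G) (pow_is_monoid T G).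
exact: bij_inj (kl_eval_bij T G).
Qed.

Lemma kl_hom_pow_isomorphic (T : power_monad) (G : groupType) :
  monoid_isomorphic (kl_hom T unit G) (pow T G).
Proof.
exists (fun f => f tt).
by split; [exact: kl_eval_bij|exact: kl_eval_morphism].
Qed.

Theorem theorem1 (G : groupType) :
  [/\ is_monoid (pow Pplus G),
      is_monoid (kl_hom Pplus unit G) &
      monoid_isomorphic (kl_hom Pplus unit G) (pow Pplus G)] /\
  [/\ is_monoid (pow Pfin G),
      is_monoid (kl_hom Pfin unit G) &
      monoid_isomorphic (kl_hom Pfin unit G) (pow Pfin G)].
Proof.
(* Both monads are instances of [power_monad], so the general lemmas cover all six claims. *)
by split; split; apply: pow_is_monoid || apply: kl_hom_is_monoid
  || apply: kl_hom_pow_isomorphic.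
Qed.
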